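(* Let $A$ be an $\mathfrak L$-set, regarded under the antithesis translation as an $\mathfrak I$-set $(A,=)$ with an inequality relation $\neq$, and let $U$ be an $\mathfrak L$-subset of $A$. In the antithesis translation: \begin{enumerate} \item $U$ is a complemented subset: a pair $(U,\bar U)$ of $\mathfrak I$-subsets of $A$ such that $$(x\in U)\wedge(y\in\bar U)\ \vdash_{x,y:A}\ (x\neq y).$$ (That is, $\mathfrak L$-subsets of $A$ are exactly such pairs, $U$ being the positive part and $\bar U$ the negative part.) \item $U$ is strong if and only if $\bar U$ is strongly extensional: $$(y\in\bar U)\ \vdash_{x,y:A}\ (x\neq y)\vee(x\in\bar U).$$ \end{enumerate}
   Context: Intuitionistic ($\mathfrak I$-) side. We work in intuitionistic predicate logic over types. An $\mathfrak I$-set is a type $A$ with a predicate $=$ on $A\times A$ that is an equivalence relation. An $\mathfrak I$-subset (or $\mathfrak I$-relation) of an $\mathfrak I$-set is a predicate $P$ on its underlying type with $(x=y)\wedge P(x)\vdash P(y)$. Antithesis translation. An affine ($\mathfrak L$-) predicate on a type $A$ is interpreted as a pair $P=(P^+,P^-)$ of intuitionistic predicates on $A$ with $\neg(P^+(x)\wedge P^-(x))$ for all $x$. Types and terms are unchanged. An entailment $P\vdash Q$ means that both $P^+\vdash Q^+$ and $Q^-\vdash P^-$ hold intuitionistically; $\vdash Q$ means $\top\vdash Q$ with $\top=(\mathbf 1,\mathbf 0)$ (true, false). Connectives: $$P\boxtimes Q=(P^+\wedge Q^+,(P^+\to Q^-)\wedge(Q^+\to P^-)),\qquad P\sqcap Q=(P^+\wedge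 Q^+,P^-\vee Q^-).$$ An $\mathfrak L$-set is a type $A$ with an $\mathfrak L$-predicate $\circeq$ on $A\times A$ such that $\vdash x\circeq x$, $\ x\circeq y\vdash y\circeq x$, and $(x\circeq y)\boxtimes(y\circeq z)\vdash x\circeq z$. Writing $(x\circeq y)=((x=y),(x\neq y))$, this amounts to an $\mathfrak I$-set $(A,=)$ with an inequality relation $\neq$, i.e. an irreflexive symmetric relation respecting $=$. An $\mathfrak L$-subset (or $\mathfrak L$-relation) of an $\mathfrak L$-set $A$ is an $\mathfrak L$-predicate $P$ on $A$ such that $(x\circeq y)\boxtimes P(x)\vdash_{x,y:A}P(y)$. It is strong if $(x\circeq y)\sqcap P(x)\vdash_{x,y:A}P(y)$. *)

(* Defs.v *)
From Stdlib Require Import RelationClasses.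

Set Implicit Arguments.
Unset Strict Implicit.
Unset Printing Implicit Defensive.

(** Intuitionistic logic is the logic of [Prop]: an intuitionistic predicate on
    a type [A] is a map [A -> Prop], and an entailment [P |-_(x:A) Q] is
    [forall x : A, P x -> Q x]. *)

Record iset := ISet {
  icar :> Type;
  ieq : icar -> icar -> Prop;
  ieq_equiv : Equivalence ieq
}.

Definition isubset (A : iset) (P : A -> Prop) : Prop :=
  forall x y : A, ieq x y /\ P x -> P y.

Record iset_ineq := ISetIneq {
  ineq_iset :> iset;
  ineq : ineq_iset -> ineq_iset -> Prop;
  ineq_irrefl : Irreflexive ineq;
  ineq_sym : Symmetric ineq;
  ineq_ieq : forall x x' y y' : ineq_iset,
    ieq x x' -> ieq y y' -> ineq x y -> ineq x' y'
}.

Definition complemented (A : iset_ineq) (U Ubar : A -> Prop) : Prop :=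
  isubset U /\ isubset Ubar /\ forall x y : A, U x /\ Ubar y -> ineq x y.

Definition strongly_extensional (A : iset_ineq) (P : A -> Prop) : Prop :=
  forall x y : A, P y -> ineq x y \/ P x.

(** Affine propositions in the antithesis translation.  An affine predicate on
    [A] is a map [A -> lprop], that is, a pair of predicates on [A] that are
    pointwise incompatible. *)
Record lprop := LProp {
  pos : Prop;
  neg : Prop;
  pos_neg : ~ (pos /\ neg)
}.

Declare Scope lprop_scope.
Delimit Scope lprop_scope with L.
Bind Scope lprop_scope with lprop.
Local Open Scope lprop_scope.

Definition lentails (P Q : lprop) : Prop :=
  (pos P -> pos Q) /\ (neg Q -> neg P).

Program Definition ltop : lprop := @LProp True False _.
Next Obligation. tauto. Qed.

Program Definition ltensor (P Q : lprop) : lprop :=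
  @LProp (pos P /\ pos Q) ((pos P -> neg Q) /\ (pos Q -> neg P)) _.
Next Obligation. destruct P, Q; simpl in *; tauto. Qed.

Program Definition lmeet (P Q : lprop) : lprop :=
  @LProp (pos P /\ pos Q) (neg P \/ neg Q) _.
Next Obligation. destruct P, Q; simpl in *; tauto. Qed.

Notation "P ⊢ Q" := (lentails P Q) (at level 80, no associativity) : type_scope.
Notation "P ⊠ Q" := (ltensor P Q) (at level 40, left associativity) : lprop_scope.
Notation "P ⊓ Q" := (lmeet P Q) (at level 40, left associativity) : lprop_scope.

Record lset := LSet {
  lcar :> Type;
  leq : lcar -> lcar -> lprop;
  leq_refl : forall x, ltop ⊢ leq x x;
  leq_sym : forall x y, leq x y ⊢ leq y x;
  leq_trans : forall x y z, leq x y ⊠ leq y z ⊢ leq x z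
}.

Record lsubset (A : lset) := LSubset {
  lmem :> A -> lprop;
  lmemP : forall x y : A, leq x y ⊠ lmem x ⊢ lmem y
}.

Definition strong (A : lset) (U : lsubset A) : Prop :=
  forall x y : A, leq x y ⊓ U x ⊢ U y.

Definition pos_part (A : lset) (U : lsubset A) (x : A) : Prop := pos (U x).
Definition neg_part (A : lset) (U : lsubset A) (x : A) : Prop := neg (U x).

(** An affine set regarded as an intuitionistic set with an inequality: the
    equality is the positive part of [leq], the inequality its negative part. *)
Section Antithesis.
Variable A : lset.

Lemma pos_leq_equiv : Equivalence (fun x y : A => pos (leq x y)).
Proof.
split.
- intro x; exact (proj1 (leq_refl x) I).
- intros x y; exact (proj1 (leq_sym x y)).
- intros x y z Hxy Hyz; exact (proj1 (leq_trans x y z) (conj Hxy Hyz)).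
Qed.

Definition iset_of_lset : iset := ISet pos_leq_equiv.

Lemma neg_leq_irrefl : Irreflexive (fun x y : iset_of_lset => neg (leq x y)).
Proof. intros x; exact (proj2 (leq_refl x)). Qed.

Lemma neg_leq_sym : Symmetric (fun x y : iset_of_lset => neg (leq x y)).
Proof. intros x y; exact (proj2 (leq_sym y x)). Qed.

Lemma neg_leq_ieq (x x' y y' : iset_of_lset) :
  ieq x x' -> ieq y y' -> neg (leq x y) -> neg (leq x' y').
Proof.
intros Hx Hy H.
apply (proj2 (proj2 (leq_trans x' y' y) (proj1 (proj2 (leq_trans x x' y) H) Hx))).
exact (proj1 (leq_sym y y') Hy).
Qed.

Definition iset_ineq_of_lset : iset_ineq :=
  ISetIneq neg_leq_irrefl neg_leq_sym neg_leq_ieq.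
End Antithesis.

(* Main.v *)
Require Import Defs.

(** The entailment defining an affine subset [U] unfolds into three conditions:
    its positive half says that the positive part respects equality, and its
    negative half turns [neg (U y)] into both [pos (leq x y) -> neg (U x)],
    i.e. the negative part respects equality, and
    [pos (U x) -> neg (leq x y)], i.e. the two parts are separated by
    the inequality.  These are the clauses of a complemented subset.
    Conversely, separation and irreflexivity of the inequality make the two parts
    incompatible, so every complemented subset consists of affine propositions.

    Replacing [⊠] by [⊓] leaves the positive half of the entailment unchanged, so
    strength adds to the subset condition only its negative half, and for [⊓]
    this is literally strong extensionality of the negative part. *)

(** The multiplicative conjunction is refuted by two implications: one is
    extensionality of the negative part, the other the separation of the two
    parts. *)
Lemma lsubset_complemented (A : lset) (U : lsubset A) :
  complemented (A := iset_ineq_of_lset A) (pos_part U) (neg_part U).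
Proof.
split; [| split].
- intros x y; exact (proj1 (lmemP U x y)).
- intros x y [Hxy Ux].
  (* The negative half of an entailment runs backwards, hence [y] before [x]. *)
  exact (proj1 (proj2 (lmemP U y x) Ux) (proj1 (leq_sym x y) Hxy)).
- intros x y [Ux Uy]; exact (proj2 (proj2 (lmemP U x y) Uy) Ux).
Qed.

(** A point in both parts would be unequal to itself. *)
Lemma complemented_disjoint (A : iset_ineq) (V W : A -> Prop) :
  complemented V W -> forall x, ~ (V x /\ W x).
Proof.
intros [_ [_ sep]] x H; exact (ineq_irrefl (sep x x H)).
Qed.

(** The two parts are recovered up to [eta], so that no extensionality principle
    enters the equalities. *)
Lemma complemented_lsubset (A : lset) (V W : A -> Prop) :
  complemented (A := iset_ineq_of_lset A) V W ->
  exists U : lsubset A, pos_part U = V /\ neg_part U = W.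
Proof.
intros VW; pose proof VW as [extV [extW sep]].
unshelve eexists (@LSubset A
  (fun x => LProp (complemented_disjoint (iset_ineq_of_lset A) V W VW x)) _).
- intros x y; split; [exact (extV x y) |].
  intros Wy; split.
  + intros Hxy; exact (extW y x (conj (proj1 (leq_sym x y) Hxy) Wy)).
  + intros Vx; exact (sep x y (conj Vx Wy)).
- split; reflexivity.
Qed.

(** Strength is an entailment whose negative half is strong extensionality and
    whose positive half is already part of being a subset. *)
Lemma strong_iff_strongly_extensional (A : lset) (U : lsubset A) :
  strong U <-> strongly_extensional (A := iset_ineq_of_lset A) (neg_part U).
Proof.
split.
- intros sU x y; exact (proj2 (sU x y)).
- intros seU x y; split; [exact (proj1 (lmemP U x y)) | exact (seU x y)].
Qed.

Theorem theorem6p11 (A : lset) :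
  ((forall U : lsubset A,
      complemented (A := iset_ineq_of_lset A) (pos_part U) (neg_part U)) /\
   (forall V W : A -> Prop,
      complemented (A := iset_ineq_of_lset A) V W ->
      exists U : lsubset A, pos_part U = V /\ neg_part U = W)) /\
  (forall U : lsubset A,
      strong U <-> strongly_extensional (A := iset_ineq_of_lset A) (neg_part U)).
Proof.
split; [split |].
- exact (lsubset_complemented A).
- exact (complemented_lsubset A).
- exact (strong_iff_strongly_extensional A).
Qed.
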